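(* Let $\mathbb F$ be a field, $n\geqslant 1$, $a_0,\dots,a_n\in\mathbb F$ with $a_0a_n\neq0$, $c=(c_k)_{k\in\mathbb Z}$ with $c_k\in\mathbb F$, $h\in\mathbb F^n$, and $W\in(\mathcal T_n^* )^n$, i.e. $W=(W_1,\dots,W_n)$ is an $n$-tuple of linear functionals on $\mathcal T_n$, viewed as a linear map $W:\mathcal T_n\to\mathbb F^n$. Let $\Phi=(y_1\ \cdots\ y_n)$ be a fundamental system of $\mathbb F$-valued solutions of $\sum_{l=0}^n a_lx_{k+l}=0$, $k\in\mathbb Z$, let $W_\Phi:=W\Phi\in\mathcal M_n(\mathbb F)$ be the matrix whose $i$-th column is $W y_i$, and let $H$ be the Green's function of the problem with zero initial conditions given in the context. Assume that $WHc$ is well defined (i.e. $Hc\in\mathcal T_n$). Then the problem $$\sum_{j=0}^n a_jx_{k+j}=c_k,\ k\in\mathbb Z,\qquad Wx=h,$$ has a unique solution in $\mathcal T_n$ if, and only if, $\det(W_\Phi)\neq0$. In such a case, the unique solution is $$u=\Phi W_\Phi^{-1}h+\left(H-\Phi W_\Phi^{-1}WH\right)c.$$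
   Context: $\mathscr S$ denotes the $\mathbb F$-vector space of sequences $(x_k)_{k\in\mathbb Z}$ with values in $\mathbb F$. $\mathcal T_n\subset\mathscr S$ is the $\mathbb F$-vector space generated by all $\mathbb F$-valued solutions of homogeneous order $n$ recurrences $\sum_{l=0}^n b_lx_{k+l}=0$, $k\in\mathbb Z$, with $b_l\in\mathbb F$, $b_0b_n\neq0$. $\mathcal T_n^*$ is its algebraic dual. For $K\in\mathbb F^n$, $\Phi K:=\sum_{i=1}^nK_iy_i$; the general $\mathbb F$-valued solution of the homogeneous recurrence is $\Phi K$. Definition of $H$: let $z_1,\dots,z_n$ be the $\mathbb F$-valued solutions $z_i=(z_{i,k})_{k\in\mathbb Z}$ of $\sum_{l=0}^na_lx_{k+l}=0$ with $z_{i,j}=1$ if $j=i-1$ and $0$ otherwise, $j\in\{0,\dots,n-1\}$. Let $\widetilde H_{k,j}$ be the $n\times n$ determinant whose first row is $(z_{1,k},\dots,z_{n,k})$ and whose remaining rows are $(z_{1,j+m},\dots,z_{n,j+m})$, $m=1,\dots,n-1$, and let $C_j:=\widetilde H_{j,j}$ (which is nonzero for every $j$). Then $H_{k,j}=\frac{(-1)^{n-1}}{a_nC_{j+1}}\widetilde H_{k,j}$ if $k>j\geqslant0$; $H_{k,j}=\frac{1}{a_0C_j}\widetilde H_{k,j}$ if $k+1-n\leqslant j<0$; and $H_{k,j}=0$ otherwise. $Hc$ is the sequence $(Hc)_k=\sum_{j\in\mathbb Z}H_{k,j}c_j$ (a finite sum for each $k$), and $WHc$ means $W(Hc)$. *)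

(* Defs.v *)
From HB Require Import structures.
From mathcomp Require Import all_boot all_order all_algebra.
From mathcomp Require Import boolp classical_sets functions cardinality fsbigop.

Set Implicit Arguments.
Unset Strict Implicit.
Unset Printing Implicit Defensive.

Import GRing.Theory.
Local Open Scope ring_scope.

(* [F^o] makes sequences an [lmodType F] under the pointwise operations. *)
Notation seqZ F := (int -> F^o).

Section Recurrences.
Variables (F : fieldType) (n : nat).
Implicit Types (a b : 'I_n.+1 -> F) (x : seqZ F).

Definition recurrence b x : seqZ F :=
  fun k : int => \sum_(l < n.+1) b l * x (k + l%:Z).

Definition order_n b : Prop := b ord0 * b ord_max != 0.

Definition homogeneous_solution b x : Prop := forall k, recurrence b x k = 0.

Definition order_n_solution x : Prop :=
  exists b, order_n b /\ homogeneous_solution b x.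

(* The recurrence may differ from one generator to another. *)
Definition calT : {pred seqZ F} := fun x =>
  `[< exists (m : nat) (s : 'I_m -> F) (y : 'I_m -> seqZ F),
        (forall i, order_n_solution (y i)) /\ x = \sum_(i < m) s i *: y i >].

Fact calT_submod_closed : submod_closed calT.
Proof.
split=> [|t x1 x2 /asboolP[m1 [s1 [y1 [sy1 ->]]]] /asboolP[m2 [s2 [y2 [sy2 ->]]]]].
  apply/asboolP; exists 0%N, (fun=> 0), (fun=> 0).
  by split=> [[]//|]; rewrite big_ord0.
apply/asboolP; exists (m1 + m2)%N.
exists (fun i : 'I_(m1 + m2) => match fintype.split i with inl j => t * s1 j | inr j => s2 j end).
exists (fun i : 'I_(m1 + m2) => match fintype.split i with inl j => y1 j | inr j => y2 j end).
split=> [i|]; first by case: (fintype.split i).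
rewrite big_split_ord scaler_sumr; congr (_ + _); apply: eq_bigr => i _.
  by rewrite (unsplitK (inl i)) scalerA.
by rewrite (unsplitK (inr i)).
Qed.

HB.instance Definition _ :=
  GRing.isSubmodClosed.Build F (seqZ F) calT calT_submod_closed.

Definition Tspace : Type := {x : seqZ F | x \in calT}.
HB.instance Definition _ := [isSub of Tspace for sval].
HB.instance Definition _ := [Choice of Tspace by <:].
HB.instance Definition _ := [SubChoice_isSubLmodule of Tspace by <:].

Definition fundamental_system a (y : 'I_n -> seqZ F) : Prop :=
  (forall i, homogeneous_solution a (y i)) /\
  (forall K : 'I_n -> F, \sum_i K i *: y i = 0 -> forall i, K i = 0).

Definition canonical_solutions a (z : 'I_n -> seqZ F) : Prop :=
  (forall i, homogeneous_solution a (z i)) /\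
  (forall i j : 'I_n, z i j%:Z = (j == i)%:R).

Section Green.
Variables (a : 'I_n.+1 -> F) (z : 'I_n -> seqZ F).

Definition Htilde (k j : int) : F :=
  \det (\matrix_(m < n, i < n) z i (if m == 0%N :> nat then k else j + m%:Z)).

Definition Cdet (j : int) : F := Htilde j j.

Definition green (k j : int) : F :=
  if (0 <= j) && (j < k) then
    (-1) ^+ n.-1 / (a ord_max * Cdet (j + 1)) * Htilde k j
  else if (k + 1 - n%:Z <= j) && (j < 0) then
    (a ord0 * Cdet j)^-1 * Htilde k j
  else 0.

(* A finitely supported sum over all integers: for fixed [k], [green k j] is
   nonzero for finitely many [j] only. *)
Definition green_op (c : seqZ F) : seqZ F :=
  fun k => \sum_(j \in [set: int]) green k j * c j.

End Green.

Implicit Types (W : 'I_n -> {scalar Tspace}) (y : 'I_n -> Tspace).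

Definition condition_map W (x : Tspace) : 'cV[F]_n := \col_i W i x.

Definition Phi y (K : 'cV[F]_n) : Tspace := \sum_i K i 0 *: y i.

Definition W_Phi W y : 'M[F]_n := \matrix_(i, j) W i (y j).

Definition is_solution a (c : seqZ F) W (h : 'cV[F]_n) (x : Tspace) : Prop :=
  (forall k, recurrence a (val x) k = c k) /\ condition_map W x = h.

End Recurrences.

Arguments calT : clear implicits.

(* Main.v *)
Require Import Defs.
From HB Require Import structures.
From mathcomp Require Import all_boot all_order all_algebra zify ring.
From mathcomp Require Import boolp classical_sets functions cardinality fsbigop.

(** Because both end coefficients of the recurrence are nonzero, it can be run
    forwards and backwards from any [n] consecutive values, so a homogeneous
    solution that vanishes at [n] consecutive places is zero
    ([homogeneous_solution_eq0]).  Hence the Casorati matrix of a fundamental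
    system is invertible at every place ([casorati_det_neq0]), a fundamental
    system spans all homogeneous solutions ([fundamental_system_span]), and the
    determinants [Cdet] that normalise the Green's function are nonzero.

    The sequence [Hc] solves the inhomogeneous recurrence because each column
    of [H] has a unit impulse as image ([recurrence_green]).  The column at [j]
    is a homogeneous solution that vanishes at [j + 1], ..., [j + n - 1], set
    to zero on one side of that gap.  Apart from zeros of the gap, every window
    of [n + 1] consecutive places other than [j], ..., [j + n] sees the kept side
    only or the erased side only, so the recurrence still gives zero there; at
    [j] a single end coefficient contributes, and [H] is scaled to make this
    contribution [1].

    It follows that the solutions of the recurrence in [Tspace] are exactly the
    [Hc + Phi y K], and the boundary condition on such a sequence is the linear
    system [W_Phi W y *m K = h - condition_map W Hc] ([is_solutionP]).  Since
    [Phi y] is injective, the problem has a unique solution if and only if this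
    square system has one, that is, if and only if [W_Phi W y] is invertible;
    solving it for [K] gives the formula. *)

Set Implicit Arguments.
Unset Strict Implicit.
Unset Printing Implicit Defensive.

Import Order.TTheory GRing.Theory Num.Theory.
Local Open Scope ring_scope.

(** * Solutions of the homogeneous recurrence *)

Section Solutions.
Variables (F : fieldType) (n : nat).
Implicit Types (b : 'I_n.+1 -> F) (x : seqZ F) (k j : int).

Fact recurrence_linear b : linear (recurrence b).
Proof.
move=> t x1 x2; apply/funext => k.
rewrite -[RHS]/(t * recurrence b x1 k + recurrence b x2 k) /recurrence mulr_sumr.
rewrite -big_split; apply: eq_bigr => l _.
rewrite -[X in _ * X]/(t * x1 (k + l%:Z) + x2 (k + l%:Z)).
by rewrite mulrDr mulrCA.
Qed.

HB.instance Definition _ b :=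
  GRing.isLinear.Build F (seqZ F) (seqZ F) *:%R (recurrence b)
    (recurrence_linear b).

Lemma homogeneous_solutionE b x :
  homogeneous_solution b x <-> recurrence b x = 0.
Proof. by split=> [hx|hx k]; [apply/funext => k; apply: hx|rewrite hx]. Qed.

Lemma homogeneous_solution_sum b m (s : 'I_m -> F) (y : 'I_m -> seqZ F) :
  (forall i, homogeneous_solution b (y i)) ->
  homogeneous_solution b (\sum_i s i *: y i).
Proof.
move=> hy; apply/homogeneous_solutionE; rewrite linear_sum big1// => i _.
by rewrite linearZ /= (homogeneous_solutionE b (y i)).1 ?scaler0.
Qed.

(** A window of [n] zeros moves one step to the right by dividing by
    [b ord_max], and one step to the left by dividing by [b ord0], so it reaches
    every place. *)
Lemma homogeneous_solution_eq0 b x j :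
  order_n b -> homogeneous_solution b x ->
  (forall m : 'I_n, x (j + m%:Z) = 0) -> x = 0.
Proof.
rewrite /order_n mulf_eq0 => /norP[b0 bn] hx hj.
have window d (m : 'I_n) : x (j + d + m%:Z) = 0.
  elim/int_ind: d m => [|d IH|d IH] m; first by rewrite addr0.
  - have [lt_mn|le_nm] := ltnP m.+1 n.
      by rewrite -(IH (Ordinal lt_mn)); congr x => /=; lia.
    have := hx (j + d%:Z); rewrite /recurrence big_ord_recr big1 => [|l _].
      rewrite Monoid.simpm => /eqP; rewrite mulf_eq0 (negbTE bn) => /eqP <-.
      by congr x; have := ltn_ord m; move=> /=; lia.
    by rewrite IH mulr0.
  - case: (posnP m) => [m0|m_gt0].
      have := hx (j + - d.+1%:Z); rewrite /recurrence big_ord_recl big1 => [|l _].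
        rewrite addr0 m0 => /eqP; rewrite mulf_eq0 (negbTE b0) => /eqP <-.
        by congr x.
      rewrite [X in _ * X](_ : _ = 0) ?mulr0// -(IH l).
      by congr x => /=; rewrite /bump /=; lia.
    have lt_mn : (m.-1 < n)%N by have := ltn_ord m; lia.
    by rewrite -(IH (Ordinal lt_mn)); congr x => /=; lia.
(* The value at [k] is read off the recurrence at [k] from the window that
   starts at [k + 1]; this also covers [n = 0], where windows are empty. *)
apply/funext => k; have := hx k; rewrite /recurrence big_ord_recl big1 => [|l _].
  by rewrite !addr0 => /eqP; rewrite mulf_eq0 (negbTE b0) => /eqP.
rewrite [X in _ * X](_ : _ = 0) ?mulr0// -(window (k + 1 - j) l).
by congr x; rewrite /= /bump /=; lia.
Qed.

Definition casorati (y : 'I_n -> seqZ F) j : 'M[F]_n :=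
  \matrix_(m, i) y i (j + m%:Z).

Lemma casorati_mul y j (K : 'cV[F]_n) m :
  (casorati y j *m K) m 0 = (\sum_i K i 0 *: y i) (j + m%:Z).
Proof.
rewrite mxE fct_sumE; apply: eq_bigr => i _.
by rewrite mxE mulrC.
Qed.

(** A kernel vector of the Casorati matrix is a combination of the [y i] with
    [n] consecutive zeros, hence the zero combination. *)
Lemma casorati_det_neq0 b (y : 'I_n -> seqZ F) j :
  order_n b -> fundamental_system b y -> \det (casorati y j) != 0.
Proof.
move=> hb [hy free_y]; rewrite -det_tr; apply/det0P => -[v v_neq0 vA].
have Av : casorati y j *m v^T = 0.
  by apply: trmx_inj; rewrite trmx_mul trmxK vA trmx0.
case/eqP: v_neq0; apply/rowP => i; rewrite mxE.
apply: (free_y (v 0)); apply: (@homogeneous_solution_eq0 b _ j hb) => [|m].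
  exact: homogeneous_solution_sum.
rewrite (eq_bigr (fun i => v^T i 0 *: y i)) => [|l _]; last by rewrite mxE.
by rewrite -casorati_mul Av mxE.
Qed.

(** The coefficients are those that match [x] at the places [0], ..., [n - 1];
    the invertible Casorati matrix at [0] provides them. *)
Lemma fundamental_system_span b (y : 'I_n -> seqZ F) x :
  order_n b -> fundamental_system b y -> homogeneous_solution b x ->
  exists K : 'cV[F]_n, x = \sum_i K i 0 *: y i.
Proof.
move=> hb hy hx; pose v : 'cV[F]_n := \col_m x m%:Z.
exists (invmx (casorati y 0) *m v); set K := _ *m v.
have AK : casorati y 0 *m K = v.
  by rewrite mulKVmx // unitmxE unitfE (casorati_det_neq0 _ hb hy).
apply/eqP; rewrite -subr_eq0; apply/eqP.
apply: (@homogeneous_solution_eq0 b _ 0 hb) => [|m].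
  apply/homogeneous_solutionE; rewrite linearB /=.
  rewrite !(iffLR (homogeneous_solutionE _ _)) ?subr0 //.
  by apply: homogeneous_solution_sum; case: hy.
rewrite -[LHS]/(x (0 + m%:Z) - (\sum_i K i 0 *: y i) (0 + m%:Z)).
by rewrite -casorati_mul AK mxE add0r subrr.
Qed.

Lemma canonical_fundamental b (z : 'I_n -> seqZ F) :
  canonical_solutions b z -> fundamental_system b z.
Proof.
move=> [hz z_init]; split=> // K Kz0 i.
have : (\sum_l K l *: z l) i%:Z = 0 by rewrite Kz0.
rewrite fct_sumE (bigD1 i) //= big1 => [|l l_neq_i].
  by rewrite addr0 scalrfctE z_init eqxx => <-; rewrite -[RHS]/(_ * _) mulr1.
by rewrite scalrfctE z_init eq_sym (negbTE l_neq_i) scaler0.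
Qed.

(** * Cutting a solution along a gap of zeros *)

(** The zeros at [j + 1], ..., [j + n - 1] fill the interior of the window
    [j], ..., [j + n] that the recurrence reads at [j].  Every earlier window
    meets the kept part only in these zeros, every later one lies inside the
    kept part, and at [j] only the right end of the window survives. *)
Lemma recurrence_cutoff_right b x j :
  (0 < n)%N -> homogeneous_solution b x ->
  (forall m : nat, (0 < m < n)%N -> x (j + m%:Z) = 0) ->
  forall k, recurrence b (fun i => if j < i then x i else 0) k =
            (k == j)%:R * (b ord_max * x (j + n%:Z)).
Proof.
move=> n_gt0 hx x0 k; rewrite /recurrence.
have [lt_kj|lt_jk|->] := ltgtP k j; rewrite ?mul0r ?mul1r.
- apply: big1 => l _; case: ifP => [lt_jkl|_]; rewrite ?mulr0 //.
  have := x0 (absz (k + l%:Z - j)%R); rewrite (_ : j + _ = k + l%:Z); last by lia.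
  by move=> ->; rewrite ?mulr0 //; have := ltn_ord l; lia.
- rewrite -[RHS](hx k); apply: eq_bigr => l _; rewrite ifT //; lia.
- rewrite big_ord_recr /= big1 ?add0r => [|l _].
    by rewrite ifT //; lia.
  case: ifP => [lt_jl|_]; rewrite ?mulr0 // x0 ?mulr0 //.
  by have := ltn_ord l; move: lt_jl => /=; lia.
Qed.

(** The mirror image: the kept part ends at [j + n - 1], the last zero of the
    gap, and at [j] only the left end of the window survives. *)
Lemma recurrence_cutoff_left b x j :
  (0 < n)%N -> homogeneous_solution b x ->
  (forall m : nat, (0 < m < n)%N -> x (j + m%:Z) = 0) ->
  forall k, recurrence b (fun i => if i + 1 - n%:Z <= j then x i else 0) k =
            (k == j)%:R * (b ord0 * x j).
Proof.
move=> n_gt0 hx x0 k; rewrite /recurrence.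
have [lt_kj|lt_jk|->] := ltgtP k j; rewrite ?mul0r ?mul1r.
- rewrite -[RHS](hx k); apply: eq_bigr => l _; rewrite ifT //.
  by have := ltn_ord l; lia.
- apply: big1 => l _; case: ifP => [lt_jkl|_]; rewrite ?mulr0 //.
  have := x0 (absz (k + l%:Z - j)%R); rewrite (_ : j + _ = k + l%:Z); last by lia.
  by move=> ->; rewrite ?mulr0 //; lia.
- rewrite big_ord_recl /= big1 ?addr0 => [|l _].
    by rewrite ifT //; lia.
  case: ifP => [lt_jl|_]; rewrite ?mulr0 // x0 ?mulr0 //.
  by move: lt_jl; rewrite /= /bump /=; lia.
Qed.

End Solutions.

(** * The Green's function *)

Section Green.
Variables (F : fieldType) (n : nat) (a : 'I_n.+2 -> F) (z : 'I_n.+1 -> seqZ F).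
Hypotheses (ha : order_n a) (hz : canonical_solutions a z).
Implicit Types (j k : int) (c : seqZ F).

(** The place [k] enters only the first row; expansion along it gives a
    combination of the [z i] with coefficients independent of [k]. *)
Lemma Htilde_homogeneous j : homogeneous_solution a (fun k => Htilde z k j).
Proof.
pose M k := \matrix_(m < n.+1, i < n.+1)
  z i (if m == 0%N :> nat then k else j + m%:Z).
(* The cofactors of the first row do not see it, so [0] may replace [k]. *)
rewrite (_ : (fun k => _) = \sum_i cofactor (M 0) ord0 i *: z i).
  by apply: homogeneous_solution_sum; case: hz.
apply/funext => k; rewrite fct_sumE /Htilde (expand_det_row _ ord0).
apply: eq_bigr => i _; rewrite mxE /= mulrC; congr (_ * _).
congr (_ * \det _); apply/matrixP => r s; rewrite !mxE //=.
Qed.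

Lemma Htilde_eq0 j m : (0 < m < n.+1)%N -> Htilde z (j + m%:Z) j = 0.
Proof.
move=> /andP[m_gt0 lt_mn].
apply: (@determinant_alternate _ _ _ ord0 (Ordinal lt_mn)).
  by rewrite eq_sym -val_eqE /= -lt0n.
by move=> i; rewrite !mxE /= ifN // -lt0n.
Qed.

(** The two matrices differ by moving the first row to the bottom, past [n]
    others: the expansion of the one along its first row and of the other along
    its last row have the same minors. *)
Lemma Htilde_Cdet j : Htilde z (j + n.+1%:Z) j = (-1) ^+ n * Cdet z (j + 1).
Proof.
rewrite /Cdet /Htilde (expand_det_row _ ord0) (expand_det_row _ ord_max).
rewrite mulr_sumr; apply: eq_bigr => i _; rewrite !mxE [RHS]mulrCA.
congr (_ * _); first by congr (z i _); rewrite /=; case: ifP => [/eqP|_]; lia.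
rewrite /cofactor mulrA -exprD addnA addnn add0n exprD.
rewrite -mul2n exprM sqrrN !expr1n mul1r; congr (_ * \det _).
apply/matrixP => r s; rewrite !mxE; congr (z _ _).
rewrite /= /bump /= leqNgt ltn_ord add0n add1n /=.
by case: ifP => [/eqP|_]; lia.
Qed.

Lemma Cdet_neq0 j : Cdet z j != 0.
Proof.
rewrite /Cdet /Htilde (_ : \matrix_(m, i) _ = casorati z j).
  exact: casorati_det_neq0 ha (canonical_fundamental hz).
apply/matrixP => m i; rewrite !mxE; congr (z i _).
by case: ifP => [/eqP ->|_]; rewrite ?addr0.
Qed.

(** The factor in front of [Htilde] is chosen so that the end of the window
    that survives the cut at [j] contributes exactly [1]. *)
Lemma recurrence_green j k :
  recurrence a (fun i => green a z i j) k = (k == j)%:R.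
Proof.
have /norP[a0 an] : ~~ ((a ord0 == 0) || (a ord_max == 0)) by rewrite -mulf_eq0.
pose g : seqZ F := fun i => Htilde z i j.
have gE (t : F) i : (t *: g) i = t * Htilde z i j by [].
have vanish (t : F) m : (0 < m < n.+1)%N -> (t *: g) (j + m%:Z) = 0.
  by move=> hm; rewrite gE Htilde_eq0 ?mulr0.
have hom (t : F) : homogeneous_solution a (t *: g).
  apply/homogeneous_solutionE; rewrite linearZ /=.
  by rewrite (iffLR (homogeneous_solutionE _ _) (Htilde_homogeneous j)) scaler0.
have [j_ge0|j_lt0] := leP 0 j.
  pose D := a ord_max * Cdet z (j + 1); pose t := (-1) ^+ n / D.
  rewrite (_ : (fun i => _) = fun i => if j < i then (t *: g) i else 0).
    rewrite (recurrence_cutoff_right _ (hom t) (vanish t)) // gE.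
    rewrite Htilde_Cdet.
    rewrite [X in _ * X](_ : _ = (-1) ^+ n * (-1) ^+ n * (D / D)).
      by rewrite -expr2 sqrr_sign divff ?mulf_neq0 ?Cdet_neq0 // !mulr1.
    by rewrite /t /D; ring.
  apply/funext => i; rewrite /green j_ge0 [j < 0]ltNge j_ge0 andbF /=.
  by case: ifP.
pose t := (a ord0 * Cdet z j)^-1.
rewrite (_ : (fun i => _) = fun i => if i + 1 - n.+1%:Z <= j then
    (t *: g) i else 0).
  rewrite (recurrence_cutoff_left _ (hom t) (vanish t)) // gE.
  rewrite -[Htilde z j j]/(Cdet z j) /t.
  by rewrite [X in _ * X]mulrCA mulVf ?mulr1 // mulf_neq0 ?Cdet_neq0.
by apply/funext => i; rewrite /green leNgt j_lt0 andbT.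
Qed.

Lemma green_eq0 j k : (`|k| + n.+1%:Z < `|j|) -> green a z k j = 0.
Proof. by move=> far; rewrite /green ifF ?ifF //; lia. Qed.

(** The superposition of the columns [H_{., j}] with weights [c j].  The
    recurrence at [k] reads finitely many rows, so all the sums over [j] may be
    taken over one finite interval around [0], where they can be exchanged with
    the recurrence. *)
Lemma recurrence_green_op c k : recurrence a (green_op a z c) k = c k.
Proof.
pose N := (`|k| + n.+1 + n.+1)%N.
pose r := [seq i%:Z - N%:Z | i <- iota 0 (N + N).+1].
have r_uniq : uniq r by rewrite map_inj_uniq ?iota_uniq // => i1 i2; lia.
have mem_r j : (j \in r) = (`|j| <= N)%N.
  apply/mapP/idP => [[i]|le_jN]; first by rewrite mem_iota => ? ->; lia.
  by exists (absz (j + N%:Z)%R); rewrite ?mem_iota; lia.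
have green_opE (l : 'I_n.+2) :
    green_op a z c (k + l%:Z) = \sum_(j <- r) green a z (k + l%:Z) j * c j.
  rewrite /green_op (@fsbigE _ _ _ _ _ r) // => [|j _].
    by apply: eq_bigl => j; rewrite in_setT.
  rewrite mem_r => j_far; rewrite green_eq0 ?mul0r //.
  by have := ltn_ord l; lia.
rewrite /recurrence.
under eq_bigr => l _ do rewrite green_opE mulr_sumr.
rewrite exchange_big /= (bigD1_seq k) ?mem_r //=; last by lia.
have deltaE j :
    \sum_(l < n.+2) a l * (green a z (k + l%:Z) j * c j) = (k == j)%:R * c j.
  by rewrite -recurrence_green mulr_suml; apply: eq_bigr => l _; rewrite mulrA.
rewrite deltaE eqxx mul1r big1 ?addr0 // => j j_neq_k.
by rewrite deltaE eq_sym (negbTE j_neq_k) mul0r.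
Qed.

End Green.

(** * The problem with conditions [W x = h] *)

Section BoundaryProblem.
Variables (F : fieldType) (n : nat).
Implicit Types (W : 'I_n -> {scalar Tspace F n}) (y : 'I_n -> Tspace F n).

Fact condition_map_linear W : linear (condition_map W).
Proof. by move=> t x1 x2; apply/colP => i; rewrite !mxE linearP. Qed.

HB.instance Definition _ W :=
  GRing.isLinear.Build F (Tspace F n) 'cV[F]_n *:%R (condition_map W)
    (condition_map_linear W).

Lemma val_Phi y K : val (Phi y K) = \sum_i K i 0 *: val (y i).
Proof. by rewrite raddf_sum; apply: eq_bigr => i _; apply: GRing.valZ. Qed.

Lemma PhiB y : {morph Phi y : K1 K2 / K1 - K2}.
Proof.
move=> K1 K2; rewrite /Phi -sumrB; apply: eq_bigr => i _.
by rewrite !mxE scalerBl.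
Qed.

Lemma condition_map_Phi W y K : condition_map W (Phi y K) = W_Phi W y *m K.
Proof.
apply/colP => i; rewrite !mxE linear_sum; apply: eq_bigr => j _.
by rewrite linearZ /= mxE mulrC.
Qed.

Lemma Phi_inj a y :
  fundamental_system a (fun i => val (y i)) -> injective (Phi y).
Proof.
move=> [_ free_y] K1 K2 eqK; apply/colP => i; apply/eqP; rewrite -subr_eq0.
have := free_y (fun i => (K1 - K2) i 0); rewrite -val_Phi PhiB eqK subrr raddf0.
by move=> /(_ erefl i); rewrite !mxE => ->.
Qed.

(** Given one solution [x0] of the inhomogeneous recurrence, the problem becomes
    a square linear system for the coordinates of [x - x0] in the fundamental
    system. *)
Lemma is_solutionP a c W h y (x0 x : Tspace F n) :
  order_n a -> fundamental_system a (fun i => val (y i)) ->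
  (forall k, recurrence a (val x0) k = c k) ->
  is_solution a c W h x <->
  exists2 K, x = x0 + Phi y K & W_Phi W y *m K = h - condition_map W x0.
Proof.
move=> ha hy hx0.
have valB (x1 x2 : Tspace F n) : val (x1 - x2) = val x1 - val x2 :> seqZ F.
  exact: raddfB.
have valD (x1 x2 : Tspace F n) : val (x1 + x2) = val x1 + val x2 :> seqZ F.
  exact: raddfD.
split=> [[hx Wx]|[K -> WK]].
  have : homogeneous_solution a (val (x - x0)).
    move=> k; rewrite valB linearB.
    rewrite -[LHS]/(recurrence a (val x) k - recurrence a (val x0) k).
    by rewrite hx hx0 subrr.
  move=> /(fundamental_system_span ha hy)[K]; rewrite -val_Phi => /val_inj xE.
  exists K; first by rewrite -xE addrC subrK.
  by rewrite -condition_map_Phi -xE linearB /= Wx.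
split=> [k|]; last by rewrite linearD /= condition_map_Phi WK addrC subrK.
rewrite valD linearD val_Phi; set s := \sum_i _.
rewrite -[LHS]/(recurrence a (val x0) k + recurrence a s k) hx0 /s.
rewrite homogeneous_solution_sum ?addr0 //; by case: hy.
Qed.

End BoundaryProblem.

Theorem corollary3p5 (F : fieldType) (n : nat) (n_ge1 : (1 <= n)%N)
    (a : 'I_n.+1 -> F) (ha : a ord0 * a ord_max != 0)
    (c : int -> F) (h : 'cV[F]_n) (W : 'I_n -> {scalar Tspace F n})
    (y : 'I_n -> Tspace F n) (hy : fundamental_system a (fun i => val (y i)))
    (z : 'I_n -> int -> F) (hz : canonical_solutions a z)
    (hHc : green_op a z c \in calT F n) :
  let Hc : Tspace F n := Sub (green_op a z c) hHc in
  let WP : 'M[F]_n := W_Phi W y in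
  let u : Tspace F n :=
    Phi y (invmx WP *m h) + (Hc - Phi y (invmx WP *m condition_map W Hc)) in
  ((exists! x : Tspace F n, is_solution a c W h x) <-> \det WP != 0) /\
  (\det WP != 0 -> unique (is_solution a c W h) u).
Proof.
move=> Hc WP u.
have Hc_sol k : recurrence a (val Hc) k = c k.
  rewrite SubK; clear -n_ge1 ha hz.
  by case: n n_ge1 a ha z hz => // n _ a ha z hz; exact: recurrence_green_op.
have solP x := is_solutionP W h x ha hy Hc_sol.
have u_unique : \det WP != 0 -> unique (is_solution a c W h) u.
  rewrite -unitfE -unitmxE => WP_unit.
  have uE : u = Hc + Phi y (invmx WP *m (h - condition_map W Hc)).
    by rewrite /u mulmxBr PhiB addrCA.
  split; first by apply/solP; eexists; [exact: uE | rewrite mulKVmx].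
  by move=> x /solP[K -> WK]; rewrite uE -WK mulKmx.
split=> //; split=> [[x [/solP[K xE WK] x_unique]]|/u_unique]; last by exists u.
(* If the determinant vanished, adding a kernel vector to the coordinates of
   the unique solution would produce another one. *)
rewrite -det_tr; apply/det0P => -[v v_neq0 vWP]; case/eqP: v_neq0.
have WPv : WP *m v^T = 0 by apply: trmx_inj; rewrite trmx_mul trmxK vWP trmx0.
have /x_unique : is_solution a c W h (Hc + Phi y (K + v^T)).
  by apply/solP; exists (K + v^T); rewrite // mulmxDr WPv addr0.
rewrite xE => /addrI/(Phi_inj hy)/esym/eqP; rewrite -subr_eq0 addrC addKr => /eqP.
by move/(congr1 trmx); rewrite trmxK trmx0.
Qed.
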